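(* Let $p$ be a prime with $p\equiv 1\pmod 4$, $n\ge 2$ an integer, and $A$ an integer with $|A|<p/2$ and $p\nmid A$. Let $f(x)=Ax^{(p+1)/2}\bmod p$ (least positive residue) on $I=\{1,\dots,p-1\}$, and for $0\le j\le n-1$ let $I_j=\{x:1\le x\le p-1,\ x\equiv j\pmod n\}$. Suppose $$p>\max\{(n^3+1)^2,\ 8\cdot 10^4 (n\log n)^4\}.$$ If $A$ cannot be written as $A=\frac{tp-r}{s}$ with integers $t,r,s$ satisfying $\gcd(r,s)=1$, $s>0$ and $1\le |r|+s\le n$, then $f(I_i)\cap I_j\ne\emptyset$ for all $0\le i,j\le n-1$.
   Context: $\log$ denotes the natural logarithm. *)

(* Defs.v *)
From mathcomp Require Import all_boot all_order all_algebra.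
From mathcomp Require Import all_classical all_reals all_analysis.

Set Implicit Arguments.
Unset Strict Implicit.
Unset Printing Implicit Defensive.

Import Order.TTheory GRing.Theory Num.Theory.
Local Open Scope classical_set_scope.
Local Open Scope ring_scope.

(* [%%] on int is the least nonnegative residue; it is the least positive one
   at every x in {1, ..., p - 1}, since there p does not divide
   A * x ^ ((p + 1) / 2) when p is a prime not dividing A. *)
Definition fres (p : nat) (A : int) (x : nat) : nat :=
  `|((A * x%:Z ^+ ((p + 1) %/ 2)) %% p%:Z)%Z|%N.

Definition Icl (p n j : nat) : set nat :=
  [set x | (1 <= x <= p - 1)%N /\ x = j %[mod n]].

Definition small_quotient (p n : nat) (A : int) : Prop :=
  exists t r s : int,
    [/\ gcdz r s = 1, 0 < s, 1 <= `|r| + s <= n%:Z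
      & A%:~R = (t * p%:Z - r)%:~R / s%:~R :> rat].

(* Main.v *)
(* By Euler's criterion f(x) = A x mod p when x is a quadratic residue, so it
   is enough to find a point (x, y) of the lattice L = {y = A x mod p}, inside
   the open square (0, p)^2, congruent to (i, j) mod n, with x a residue.

   Thue's lemma gives a primitive vector (s, -r) of L with |r|, s <= sqrt p, and
   the hypothesis on A says that N = |r| + s > n.  Up to y -> p - y we have
   r > 0; then L is the union of the integer points of the lines
   r x + s y = m p, of which those with 0 < m < N meet the square.  The
   congruence fixes m mod n, so N > n leaves an admissible m within n / 2 of
   N / 2, and on that line the points congruent to (i, j) are spaced by
   n (s, -r).

   A sumset B + B' with |B| |B'| >= p cannot consist of non-residues (second
   moment of sums of the quadratic character).  If N < 4 n, the line contains an
   arithmetic progression B + B' with |B| = |B'| > sqrt p.  If N >= 4 n, one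
   good point lies well inside the square, and around it one takes
   B - B with B = n S, where S is a set of points of L in a small box, found
   with the pigeonhole principle. *)
Require Import Defs.
From mathcomp Require Import all_boot all_order all_algebra all_field.
From mathcomp Require Import all_classical all_reals all_analysis.
From mathcomp Require Import zify ring lra.

Set Implicit Arguments.
Unset Strict Implicit.
Unset Printing Implicit Defensive.

Import Order.TTheory GRing.Theory Num.Theory.
Local Open Scope ring_scope.

(** * Quadratic character of a finite field of odd order *)

Section QuadraticCharacter.
Variable F : finFieldType.
Hypothesis oddF : odd #|F|.

(** Euler's criterion serves as the definition; values in [int] let character sums be compared as
    integers. *)
Definition qchar (x : F) : int :=
  if x == 0 then 0 else if x ^+ (#|F|.-1)./2 == 1 then 1 else -1.

Lemma qchar0 : qchar 0 = 0.
Proof. by rewrite /qchar eqxx. Qed.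

Lemma qchar1 : qchar 1 = 1.
Proof. by rewrite /qchar oner_eq0 expr1n eqxx. Qed.

Lemma half_card_exp (x : F) :
  x != 0 -> (x ^+ (#|F|.-1)./2 == 1) || (x ^+ (#|F|.-1)./2 == -1).
Proof.
move=> x0; rewrite -sqrf_eq1 -exprM muln2.
have -> : (#|F|.-1)./2.*2 = #|F|.-1 by move: oddF; lia.
apply/eqP/(mulfI x0); rewrite mulr1 -exprS prednK ?expf_card //.
by apply/card_gt0P; exists 0.
Qed.

Lemma qcharM (x y : F) : qchar (x * y) = qchar x * qchar y.
Proof.
rewrite /qchar mulf_eq0; have [_|x0] := eqVneq x 0; first by rewrite /= mul0r.
have [_|y0] := eqVneq y 0; first by rewrite /= mulr0.
rewrite exprMn /=.
have [->|xN] := eqVneq (x ^+ _) 1; first by rewrite !mul1r.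
have [->|yN] := eqVneq (y ^+ _) 1; first by rewrite mulr1 (negPf xN).
have := half_card_exp x0; rewrite (negPf xN) => /eqP ->.
have := half_card_exp y0; rewrite (negPf yN) => /eqP ->.
by rewrite mulrNN mul1r eqxx mulrNN.
Qed.

Lemma qchar_sqr (x : F) : qchar x ^+ 2 = (x != 0)%:R.
Proof. by rewrite /qchar; case: eqP => //= _; case: ifP. Qed.

(** Otherwise all [#|F| - 1] nonzero elements would be roots of a polynomial of half that degree. *)
Lemma qchar_nonresidue : exists g : F, qchar g = -1.
Proof.
have [/existsP[g /eqP]|/existsPn nog] := boolP [exists g, qchar g == -1].
  by exists g.
have F_gt1 : (1 < #|F|)%N := finNzRing_gt1 F.
set h := (#|F|.-1)./2; have h_gt0 : (0 < h)%N by rewrite /h; move: oddF; lia.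
pose s := [seq x <- enum F | x != 0].
have roots_s : all (root ('X^h - 1 : {poly F})) s.
  apply/allP => x; rewrite mem_filter => /andP[x0 _].
  rewrite rootE !hornerE subr_eq0.
  by have := nog x; rewrite /qchar (negPf x0) -/h; case: ifP.
have nz : 'X^h - 1 != 0 :> {poly F} by rewrite -size_poly_eq0 size_XnsubC.
have /(max_poly_roots nz roots_s) : uniq s by rewrite filter_uniq ?enum_uniq.
have -> : size s = #|F|.-1.
  rewrite -(cardC1 (0 : F)) cardE; congr size.
  by rewrite /s enumT; apply: eq_filter.
by rewrite size_XnsubC // /h; move: oddF; lia.
Qed.

(** Multiplication by a non-residue permutes [F] and changes the sign of the sum. *)
Lemma sum_qchar : \sum_x qchar x = 0.
Proof.
have [g gN] := qchar_nonresidue.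
have g0 : g != 0 by apply: contraPneq gN => ->; rewrite qchar0.
have : \sum_x qchar x = - \sum_x qchar x.
  rewrite {1}(reindex_inj (mulfI g0)) /= -sumrN; apply: eq_bigr => x _.
  by rewrite qcharM gN mulN1r.
by set u := \sum_x _; lia.
Qed.

(** For [x != 0] the term equals [qchar (1 + d / x)], and [1 + d / x] takes every value except 1. *)
Lemma qchar_correlation (d : F) :
  d != 0 -> \sum_x qchar x * qchar (x + d) = -1.
Proof.
move=> d0; have := sum_qchar; rewrite (bigD1 1) //= qchar1 => sum1.
rewrite (bigD1 0) //= qchar0 mul0r add0r.
suff -> : \sum_(x | x != 0) qchar x * qchar (x + d) =
          \sum_(x | x != 1) qchar x.
  by apply: (addrI 1); rewrite sum1 subrr.
rewrite [RHS](reindex_onto (fun x : F => 1 + d / x) (fun y => d / (y - 1))).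
  apply: eq_big => x /=.
    have [->|x0] := eqVneq x 0.
      by rewrite invr0 mulr0 addr0 eqxx.
    rewrite -subr_eq0 (addrC 1) addrK mulf_neq0 ?invr_eq0 //=.
    by rewrite invf_div mulrCA divff // mulr1 eqxx.
  move=> x0; have -> : x + d = x * (1 + d / x).
    by rewrite mulrDr mulr1 mulrCA divff // mulr1.
  by rewrite qcharM mulrA -expr2 qchar_sqr x0 mul1r.
move=> y y1 /=; rewrite invf_div mulrCA divff // mulr1 addrC subrK //.
Qed.

(* Second moment method: if [qchar] were -1 on all the sums, the terms with [x]
   in the image of [f1] would make
   [\sum_x (\sum_t qchar (x + f2 t)) ^+ 2 = #|T2| (#|F| - #|T2|)] too large. *)
Lemma qchar_sumset (T1 T2 : finType) (f1 : T1 -> F) (f2 : T2 -> F) :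
  injective f1 -> injective f2 -> (#|F| <= #|T1| * #|T2|)%N ->
  exists t1 t2, qchar (f1 t1 + f2 t2) != -1.
Proof.
move=> f1I f2I le_F.
have [/existsP[t1 /existsP[t2 ?]]|/existsPn allN] :=
  boolP [exists t1, exists t2, qchar (f1 t1 + f2 t2) != -1].
  by exists t1, t2.
have {}allN t1 t2 : qchar (f1 t1 + f2 t2) = -1.
  by have /existsPn/(_ t2) := allN t1; rewrite negbK => /eqP.
have F_gt0 : (0 < #|F|)%N by apply/card_gt0P; exists 0.
have second_moment : \sum_x (\sum_t qchar (x + f2 t)) ^+ 2 =
    #|T2|%:Z * (#|F|%:Z - #|T2|%:Z).
  under eq_bigr => x _ do rewrite expr2 big_distrlr /=.
  rewrite exchange_big /=; under eq_bigr => t _ do rewrite exchange_big /=.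
  have inner t t' : \sum_x qchar (x + f2 t) * qchar (x + f2 t') =
      if t' == t then #|F|%:Z - 1 else -1.
    rewrite (reindex_inj (addIr (- f2 t))) /=.
    under eq_bigr => x _ do rewrite addrNK.
    have [->|t't] := eqVneq t' t.
      under eq_bigr => x _ do rewrite addrNK -expr2 qchar_sqr.
      rewrite (bigD1 0) //= eqxx add0r.
      under eq_bigr => x x0 do rewrite x0.
      by rewrite sumr_const (cardC1 (0 : F)) mulr1n natz (subzn F_gt0) subn1.
    under eq_bigr => x _ do rewrite -addrA (addrC (- _)).
    by rewrite qchar_correlation // subr_eq0 (inj_eq f2I).
  under eq_bigr => t _.
    under eq_bigr => t' _ do rewrite inner.
    rewrite (bigD1 t) //= eqxx.
    under eq_bigr => t' t't do rewrite (negPf t't).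
    rewrite sumr_const cardC1; over.
  have [T20|T2_gt0] := posnP #|T2|.
    rewrite T20 mul0r big_pred0 // => t.
    by have := fintype0 t T20.
  rewrite sumr_const (eq_card (B := T2)) // -[LHS]mulr_natl natz.
  rewrite -[-1 *+ _]mulr_natl natz.
  move: T2_gt0; move: #|T2| #|F| => M N; nia.
have : #|T1|%:Z * #|T2|%:Z ^+ 2 <= #|T2|%:Z * (#|F|%:Z - #|T2|%:Z).
  rewrite -second_moment (bigID (mem (f1 @: [set: T1]))) /=.
  rewrite -[leLHS]addr0; apply: lerD; last first.
    by apply: sumr_ge0 => x _; apply: sqr_ge0.
  rewrite big_imset /=; last by move=> ? ? _ _; apply: f1I.
  under eq_bigr => t _.
    under eq_bigr => t' _ do rewrite allN.
    rewrite sumr_const; over.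
  rewrite sumr_const cardsT -[leRHS]mulr_natl natz.
  rewrite -[-1 *+ _]mulr_natl natz.
  move: #|T1| #|T2| => M N; nia.
move: le_F F_gt0; move: #|T1| #|T2| #|F| => M N Q; nia.
Qed.
End QuadraticCharacter.

(** * Divisibility by [p], and residues in integer sumsets *)

Lemma dvdz_lt_eq0 (d x : int) : (d %| x)%Z -> `|x| < d -> x = 0.
Proof. by case/dvdzP=> k ->; have [] := ltrgt0P k; nia. Qed.

Lemma dvdz_Fp (p : nat) (x : int) :
  prime p -> (p%:Z %| x)%Z = (x%:~R == 0 :> 'F_p).
Proof. by move=> p_prime; apply: (dvdz_pcharf (pchar_Fp p_prime)). Qed.

(** The character may also vanish, whence the first alternative; size excludes it later, the sum
    lying strictly between 0 and [p]. *)
Lemma int_sumset_residue (p : nat) (T1 T2 : finType) (f1 : T1 -> int)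
    (f2 : T2 -> int) :
  prime p -> odd p ->
  (forall t t', (p%:Z %| f1 t - f1 t')%Z -> t = t') ->
  (forall t t', (p%:Z %| f2 t - f2 t')%Z -> t = t') ->
  (p <= #|T1| * #|T2|)%N ->
  exists t1 t2, (p%:Z %| f1 t1 + f2 t2)%Z \/
                (p%:Z %| (f1 t1 + f2 t2) ^+ p.-1./2 - 1)%Z.
Proof.
move=> p_prime p_odd f1I f2I le_p.
have [||||t1 [t2]] := @qchar_sumset 'F_p _ T1 T2 (fun t => (f1 t)%:~R)
  (fun t => (f2 t)%:~R); rewrite ?card_Fp //.
- by move=> t t' /eqP; rewrite -subr_eq0 -rmorphB -dvdz_Fp // => /f1I.
- by move=> t t' /eqP; rewrite -subr_eq0 -rmorphB -dvdz_Fp // => /f2I.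
rewrite -rmorphD /qchar card_Fp // => H; exists t1, t2.
rewrite !dvdz_Fp // rmorphB rmorphXn rmorph1 subr_eq0.
by move: H; case: (_ == 0); [left | case: (_ == 1); [right |]].
Qed.

(** * Pigeonhole arguments and Thue's lemma *)

Lemma pigeonhole_fiber (T U : finType) (g : T -> U) :
  (0 < #|T|)%N -> exists c, (#|T| <= #|[set t | g t == c]| * #|U|)%N.
Proof.
case/card_gt0P=> t0 _.
pose c := [arg max_(c > g t0) #|[set t | g t == c]|].
have maxc d : (#|[set t | g t == d]| <= #|[set t | g t == c]|)%N.
  by rewrite /c; case: arg_maxnP => // c' _; apply.
exists c; rewrite mulnC -sum_nat_const -[leqLHS]sum1_card.
rewrite (partition_big g predT) //=.
apply: leq_sum => d _; apply: leq_trans (maxc d).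
by rewrite sum1_card cardsE.
Qed.

(** Among the more than [p] pairs [(a, b)] with entries at most [q], two agree in [A a + b] mod [p];
    their difference, divided by its gcd, is the vector sought. *)
Lemma thue (p q : nat) (A : int) :
  prime p -> (q < p)%N -> (p < q.+1 ^ 2)%N ->
  exists r s : int, [/\ coprimez r s, 0 < s <= q%:Z, `|r| <= q%:Z
                      & (p%:Z %| A * s + r)%Z].
Proof.
move=> p_prime lt_qp lt_pq.
pose g (t : 'I_q.+1 * 'I_q.+1) : 'F_p := (A * t.1%:Z + t.2%:Z)%:~R.
have : ~~ injectiveb g.
  apply/negP => /injectiveP/leq_card; rewrite card_prod !card_ord Fp_cast //.
  by nia.
case/injectivePn => -[a b] [[a' b'] ab_neq /eqP].
rewrite /g /= -subr_eq0 -rmorphB -dvdz_Fp // => dvd_ab.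
have [lta ltb lta' ltb'] : [/\ a <= q, b <= q, a' <= q & b' <= q]%N.
  by split; rewrite -ltnS ltn_ord.
have [r [s [s_gt0 s_le r_le dvd_rs]]] : exists r s : int,
    [/\ 0 < s, s <= q%:Z, `|r| <= q%:Z & (p%:Z %| A * s + r)%Z].
  have [ltaa'|lta'a|eqaa'] := ltngtP a a'.
  - exists (b'%:Z - b%:Z), (a'%:Z - a%:Z); split; try lia.
    rewrite (_ : _ + _ = - (A * a%:Z + b%:Z - (A * a'%:Z + b'%:Z))).
      by rewrite rpredN.
    by ring.
  - exists (b%:Z - b'%:Z), (a%:Z - a'%:Z); split; try lia.
    rewrite (_ : _ + _ = A * a%:Z + b%:Z - (A * a'%:Z + b'%:Z)) //.
    by ring.
  - move: ab_neq dvd_ab; rewrite (ord_inj eqaa') => bb' dvd_b.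
    suff /ord_inj eqb : b = b' :> nat by rewrite eqb eqxx in bb'.
    have {dvd_b} : (p%:Z %| b%:Z - b'%:Z)%Z by move: dvd_b; congr dvdz; ring.
    by move/dvdz_lt_eq0; lia.
have g_neq0 : gcdz r s != 0 by rewrite gcdz_eq0; lia.
have g_gt0 : 0 < gcdz r s by rewrite lt_def g_neq0.
have [/dvdzP[r' r'E] /dvdzP[s' s'E]] := (dvdz_gcdl r s, dvdz_gcdr r s).
set d := gcdz r s in g_neq0 g_gt0 r'E s'E.
have cop' : coprimez r' s'.
  rewrite /coprimez -(inj_eq (mulfI g_neq0)) mulr1 -{1}(gtz0_abs g_gt0).
  by rewrite mulz_gcdr !(mulrC d) -r'E -s'E.
have s'_gt0 : 0 < s' by rewrite -(pmulr_lgt0 _ g_gt0) -s'E.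
have d_le : d <= q%:Z by nia.
exists r', s'; split=> //; try nia.
(* As [0 < d <= q < p], the gcd is prime to [p] and cancels. *)
rewrite -(@Gauss_dvdzr _ d); last first.
  by rewrite coprimezE prime_coprime // gtnNdvd //; lia.
by rewrite mulrDr mulrCA !(mulrC d) -r'E -s'E.
Qed.

(** * Points of a line in a class mod [n] *)

(** [a] and [b] are margins from the sides of the square. The first two bounds leave room for one
    step [n (s, -r)] in each coordinate; the last two keep the line away from the corners [(a, b)]
    and [(p - a, p - b)]. *)
Lemma coset_point (r s m p i j n a b : int) :
  0 < r -> 0 < s -> 0 < n -> coprimez r s ->
  (n %| r * i + s * j - m * p)%Z ->
  2 * a + n * s < p -> 2 * b + n * r < p ->
  r * a + s * b + n * r * s < m * p ->
  r * a + s * b + n * r * s < (r + s - m) * p ->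
  exists x y, [/\ (n %| x - i)%Z, (n %| y - j)%Z, r * x + s * y = m * p,
                  a < x < p - a & b < y < p - b].
Proof.
move=> r_gt0 s_gt0 n_gt0 /coprimezP[[u v] /= uv] /dvdzP[e eE] pa pb pm pm'.
(* By Bezout, shifting [(i, j)] by [- n e (u, v)] puts it on the line without changing its class. *)
pose x1 := i - n * u * e; pose y1 := j - n * v * e.
have line1 : r * x1 + s * y1 = m * p.
  rewrite /x1 /y1; have -> : m * p = r * i + s * j - e * n by rewrite -eE; ring.
  by rewrite -[e * n]mulr1 -uv; ring.
have ns_gt0 : 0 < n * s by rewrite mulr_gt0.
have nr_gt0 : 0 < n * r by rewrite mulr_gt0.
(* The first point of the line past both [x = a] and [y = p - b]. *)
pose ka := ((a - x1) %/ (n * s))%Z + 1.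
pose kb := ((y1 - (p - b)) %/ (n * r))%Z + 1.
have kaP : x1 + n * s * (ka - 1) <= a < x1 + n * s * ka.
  have := divz_eq (a - x1) (n * s); have := ltz_pmod (a - x1) ns_gt0.
  have := modz_ge0 (a - x1) (lt0r_neq0 ns_gt0).
  rewrite /ka addrK; set d := (_ %/ _)%Z; nia.
have kbP : y1 - n * r * kb < p - b <= y1 - n * r * (kb - 1).
  have := divz_eq (y1 - (p - b)) (n * r).
  have := ltz_pmod (y1 - (p - b)) nr_gt0.
  have := modz_ge0 (y1 - (p - b)) (lt0r_neq0 nr_gt0).
  rewrite /kb addrK; set d := (_ %/ _)%Z; nia.
move: ka kb kaP kbP => ka kb kaP kbP.
have dvdx k : (n %| x1 + n * s * k - i)%Z.
  by apply/dvdzP; exists (s * k - u * e); rewrite /x1; ring.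
have dvdy k : (n %| y1 - n * r * k - j)%Z.
  by apply/dvdzP; exists (- r * k - v * e); rewrite /y1; ring.
have line k : r * (x1 + n * s * k) + s * (y1 - n * r * k) = m * p.
  by rewrite -line1; ring.
(* At the larger index both bounds hold. The coordinate that fixes this index is at most one step
   past its bound, and the line equation controls the other. *)
have [le_ab|lt_ba] := leP kb ka.
  exists (x1 + n * s * ka), (y1 - n * r * ka); split=> //.
    by nia.
  have := line ka; set x := x1 + _; set y := y1 - _ => xy.
  have x_le : x <= a + n * s by rewrite /x; nia.
  have y_lt : y < p - b by rewrite /y; nia.
  rewrite y_lt andbT.
  have : r * x <= r * (a + n * s) by rewrite ler_pM2l.
  by move=> rx; rewrite -(ltr_pM2l s_gt0); lia.
exists (x1 + n * s * kb), (y1 - n * r * kb); split=> //; last by nia.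
have := line kb; set x := x1 + _; set y := y1 - _ => xy.
have y_ge : p - b - n * r <= y by rewrite /y; nia.
have -> : a < x by rewrite /x; nia.
have : s * (p - b - n * r) <= s * y by rewrite ler_pM2l.
by move=> sy /=; rewrite -(ltr_pM2l r_gt0); lia.
Qed.

(** The class of [m] mod [n] is that of [v c]; its representative is taken among [n] consecutive
    integers starting at [(N - n) / 2] rounded up. *)
Lemma balanced_residue (n p c N : int) :
  0 < n -> coprimez n p ->
  exists m, (n %| c - m * p)%Z /\ N - n <= 2 * m <= N + n.
Proof.
move=> n_gt0 /coprimezP[[u v] /= uv].
pose lo := ((N - n + 1) %/ 2)%Z; exists (lo + ((v * c - lo) %% n)%Z); split.
  have -> : ((v * c - lo) %% n)%Z = v * c - lo - ((v * c - lo) %/ n)%Z * n.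
    by rewrite {2}(divz_eq (v * c - lo) n); ring.
  set k := (_ %/ n)%Z; apply/dvdzP; exists (u * c + k * p).
  by rewrite -{1}[c]mulr1 -uv; ring.
have := ltz_pmod (v * c - lo) n_gt0.
have := modz_ge0 (v * c - lo) (lt0r_neq0 n_gt0).
by rewrite /lo; lia.
Qed.

(** * Residue points: reflection, neighbourhoods, estimates *)

(** The last clause is Euler's criterion for [x], so that [f(x) = y]. Classes are given by
    divisibility, so [i] and [j] may be any integers. *)
Definition residue_point (p : nat) (n A i j : int) : Prop :=
  exists x y : int, [/\ 0 < x < p%:Z, 0 < y < p%:Z,
    (n %| x - i)%Z /\ (n %| y - j)%Z, (p%:Z %| A * x - y)%Z
    & (p%:Z %| x ^+ p.-1./2 - 1)%Z].

Lemma residue_pointN (p : nat) (n A i j : int) :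
  residue_point p n (- A) i (p%:Z - j) -> residue_point p n A i j.
Proof.
case=> x [y [xP yP [xi yj] Axy xres]]; exists x, (p%:Z - y); split=> //.
- by move: yP; lia.
- split=> //; rewrite (_ : _ - _ - _ = - (y - (p%:Z - j))) ?rpredN //.
  by ring.
- rewrite (_ : _ - _ = - (- A * x - y) - p%:Z); last by ring.
  by rewrite rpredB ?rpredN ?dvdzz.
Qed.

(* The points around [(x0, y0)] are [x0 + n (u t - u t')]: their abscissas form
   the sumset of [x0 + n u] and [- n u]. *)
Lemma residue_point_near (p : nat) (n A a b x0 y0 : int) (T : finType)
    (u v : T -> int) :
  prime p -> odd p -> 0 < n -> injective u -> (p <= #|T| * #|T|)%N ->
  (forall t t', `|n * (u t - u t')| <= a) ->
  (forall t t', `|n * (v t - v t')| <= b) ->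
  (forall t, (p%:Z %| A * u t - v t)%Z) -> (p%:Z %| A * x0 - y0)%Z ->
  a < x0 < p%:Z - a -> b < y0 < p%:Z - b -> residue_point p n A x0 y0.
Proof.
move=> p_prime p_odd n_gt0 uI le_p ua vb Auv Axy x0P y0P.
have u_sep t t' : (p%:Z %| n * (u t - u t'))%Z -> t = t'.
  move/dvdz_lt_eq0 => /(_ _)/eqP; rewrite mulf_eq0 gt_eqF //= subr_eq0.
  by move/(_ _)/eqP => uu; apply/uI/uu; have := ua t t'; lia.
have [||t [t' [t0|tres]]] := @int_sumset_residue p T T (fun t => x0 + n * u t)
  (fun t => - (n * u t)) p_prime p_odd _ _ le_p.
- move=> t t' H; apply: u_sep; move: H; congr dvdz; ring.
- move=> t t' H; apply: u_sep; rewrite -rpredN; move: H; congr dvdz; ring.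
- have := ua t t'; rewrite mulrBr => uat.
  by move/dvdz_lt_eq0: t0; lia.
have uat := ua t t'; have vbt := vb t t'.
exists (x0 + n * (u t - u t')), (y0 + n * (v t - v t')); split.
- by lia.
- by lia.
- by split; rewrite addrC addKr dvdz_mulr.
- have -> : A * (x0 + n * (u t - u t')) - (y0 + n * (v t - v t')) =
      (A * x0 - y0) + n * ((A * u t - v t) - (A * u t' - v t')) by ring.
  by rewrite rpredD // dvdz_mull // rpredB.
- by rewrite mulrBr addrA.
Qed.

Lemma short_line_bound (n N mu q : int) :
  2 <= n -> n + 1 <= N < 4 * n -> 1 <= mu -> N - n <= 2 * mu ->
  n ^+ 3 + 1 <= q -> 70 * n ^+ 2 <= q ->
  n * N ^+ 2 * (2 * q + 1) < 4 * mu * q ^+ 2.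
Proof.
move=> n_ge2 NP mu_ge1 N_mu q_cube q_sqr.
have N2 : N ^+ 2 <= 16 * n ^+ 2 by nia.
have nN2 : n * N ^+ 2 <= 16 * n ^+ 3 by nia.
(* The 8 absorbs the remaining term: [n N ^ 2 <= 16 n ^ 3 < 16 q]. *)
suff : n * N ^+ 2 + 8 <= 2 * mu * q.
  move: nN2; set c := n * N ^+ 2; nia.
have [k1|k_ge2] := leP (N - n) 1.
  have -> : N = n + 1 by lia.
  suff : n * (n + 1) ^+ 2 + 8 <= 2 * q by nia.
  have [n_ge4|n_lt4] := leP 4 n; first by nia.
  have [->|->] : n = 2 \/ n = 3 by lia.
    by lia.
  by lia.
suff : n * N ^+ 2 + 8 <= (N - n) * q by nia.
have [n_le7|n_ge8] := leP n 7.
  suff : 16 * n ^+ 3 + 8 <= 140 * n ^+ 2 by nia.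
  by nia.
have : (N - n) * (n ^+ 3 + 1) <= (N - n) * q by nia.
set k := N - n in k_ge2 *; have -> : N = n + k by rewrite /k; lia.
have k_lt : k < 3 * n by rewrite /k; lia.
apply: le_trans; rewrite -subr_ge0.
(* Each summand is nonnegative for [2 <= k < 3 n] and [n >= 8]. *)
have -> : k * (n ^+ 3 + 1) - (n * (n + k) ^+ 2 + 8) =
    (k - 2) * (3 * n - k) * n + (k - 2) * (n ^+ 3 - 5 * n ^+ 2 - 2 * n + 1)
    + (n ^+ 3 - 4 * n ^+ 2 - 4 * n - 6) by ring.
have n2 : 8 * n <= n ^+ 2 by nia.
have n3 : 8 * n ^+ 2 <= n ^+ 3 by rewrite exprS ler_wpM2r ?sqr_ge0 //; lia.
have c1 : 0 <= (k - 2) * (3 * n - k) * n by rewrite !mulr_ge0; lia.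
have c2 : 0 <= (k - 2) * (n ^+ 3 - 5 * n ^+ 2 - 2 * n + 1).
  by rewrite mulr_ge0; lia.
by rewrite addr_ge0 ?(addr_ge0 c1 c2) //; lia.
Qed.

Lemma residue_point_mod (p : nat) (n A i j i' j' : int) :
  (n %| i - i')%Z -> (n %| j - j')%Z ->
  residue_point p n A i j -> residue_point p n A i' j'.
Proof.
move=> ii' jj' [x [y [xP yP [xi yj] Axy xres]]]; exists x, y; split=> //.
split; first by rewrite -(subrKA i) rpredD.
by rewrite -(subrKA j) rpredD.
Qed.

(** The residues of [A x] for the [p %/ k + 1 > p / k] values of [x] fall into [k] intervals of
    length [p %/ k + 1]; one interval gets more than [p / k ^ 2] of them. *)
Lemma residue_cluster (p k : nat) (A : int) :
  (0 < p)%N -> (0 < k)%N -> exists S : {set 'I_(p %/ k).+1},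
    (p < #|S| * k ^ 2)%N /\
    {in S &, forall x x' : 'I__,
      `|((A * x%:Z) %% p%:Z)%Z - ((A * x'%:Z) %% p%:Z)%Z| <= (p %/ k)%N%:Z}.
Proof.
move=> p_gt0 k_gt0; set X := (p %/ k)%N.
have lt_p : (p < k * X.+1)%N by rewrite mulnC; apply: ltn_ceil.
pose w (x : 'I_X.+1) : nat := `|((A * x%:Z) %% p%:Z)%Z|%N.
have wE (x : 'I_X.+1) : ((A * x%:Z) %% p%:Z)%Z = (w x)%:Z.
  by rewrite /w gez0_abs // modz_ge0 //; lia.
have w_lt x : (w x < p)%N.
  by have := ltz_pmod (A * x%:Z) (_ : 0 < p%:Z); rewrite wE; lia.
have g_lt x : (w x %/ X.+1 < k)%N.
  by rewrite ltn_divLR //; apply: ltn_trans lt_p.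
have [|c] := pigeonhole_fiber (fun x => Ordinal (g_lt x)); rewrite !card_ord //.
set S := [set t | _] => S_card; exists S; split.
  by rewrite -mulnn mulnA (leq_trans lt_p) // mulnC leq_mul2r S_card orbT.
have S_eq x : x \in S -> (w x %/ X.+1 = c)%N by rewrite inE => /eqP <-.
move=> x x' /S_eq xc /S_eq x'c; rewrite !wE.
have := divn_eq (w x) X.+1; have := divn_eq (w x') X.+1; rewrite xc x'c.
by have := ltn_pmod (w x) (ltn0Sn X); have := ltn_pmod (w x') (ltn0Sn X); lia.
Qed.

Lemma leq_sqr_of_ltn_mul (p a k : nat) :
  (p < a * k -> k * k <= p -> p <= a * a)%N.
Proof.
move=> lt_p le_kk; rewrite leqNgt; apply/negP => lt_aa.
have := ltn_mul lt_p lt_p; rewrite mulnACA ltnNge => /negP; apply.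
by apply: leq_mul => //; apply: ltnW.
Qed.

(** * The two regimes for [r > 0], with [q] the integer square root of [p] *)

Lemma residue_point_pos (p n q : nat) (A r s i j : int) :
  prime p -> odd p -> (2 <= n)%N -> (q ^ 2 <= p < q.+1 ^ 2)%N ->
  (n ^ 3 + 1 <= q)%N -> (70 * n ^ 2 <= q)%N ->
  0 < r <= q%:Z -> 0 < s <= q%:Z -> coprimez r s -> n%:Z + 1 <= r + s ->
  (p%:Z %| A * s + r)%Z -> residue_point p n%:Z A i j.
Proof.
move=> p_prime p_odd n_ge2 /andP[q2p pq2] q_cube q_sqr /andP[r_gt0 r_le].
move=> /andP[s_gt0 s_le] cop_rs N_ge Asr.
have q_ge : (280 <= q)%N by nia.
have lt_qp : (q < p)%N by nia.
have le_8nq : (8 * n <= q)%N by nia.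
have {}q2p : q%:Z ^+ 2 <= p%:Z by lia.
have {}pq2 : p%:Z < (q%:Z + 1) ^+ 2 by lia.
have cop_np : coprimez n%:Z p%:Z.
  by rewrite coprimezE coprime_sym /= prime_coprime // gtnNdvd //; lia.
have cop_ps : coprimez p%:Z s.
  by rewrite coprimezE prime_coprime // gtnNdvd //; lia.
have n_gt0 : 0 < n%:Z by lia.
have [m [m_mod /andP[m_lo m_hi]]] :=
  balanced_residue (r * i + s * j) (r + s) n_gt0 cop_np.
have on_line x y : r * x + s * y = m * p%:Z -> (p%:Z %| A * x - y)%Z.
  move=> xy; rewrite -(Gauss_dvdzr _ cop_ps).
  rewrite (_ : s * _ = (A * s + r) * x - m * p%:Z); last by rewrite -xy; ring.
  by rewrite rpredB ?(dvdz_mulr _ Asr) // dvdz_mull.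
have rs2 : 4 * (r * s) <= (r + s) ^+ 2.
  by have := sqr_ge0 (r - s); rewrite sqrrB sqrrD; lia.
have [N_lt|N_ge4] := ltP (r + s) (4 * n%:Z).
  have step_bound c : 0 < c -> c < 4 * n%:Z ->
      2 * (n%:Z * c * q%:Z) + n%:Z * c < p%:Z.
    move=> c_gt0 c_lt; apply: lt_le_trans q2p.
    have -> : 2 * (n%:Z * c * q%:Z) + n%:Z * c = n%:Z * c * (2 * q%:Z + 1).
      by ring.
    have : n%:Z * c <= 4 * n%:Z ^+ 2 by rewrite expr2 mulrCA ler_wpM2l //; lia.
    have : 0 < n%:Z * c by rewrite mulr_gt0.
    move: (n%:Z * c) => c' c'_gt0 c'_le.
    apply: (@le_lt_trans _ _ (3 * c' * q%:Z)).
      by rewrite (mulrC 3) -mulrA ler_wpM2l //; lia.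
    by rewrite expr2 ltr_pM2r //; lia.
  (* Used for [mu = m] and [mu = r + s - m]; both are at least 1 because [r + s > n]. *)
  have line_bound mu : 1 <= mu -> (r + s) - n%:Z <= 2 * mu ->
      r * (n%:Z * s * q%:Z) + s * (n%:Z * r * q%:Z) + n%:Z * r * s < mu * p%:Z.
    move=> mu_ge1 mu_ge.
    have bound : n%:Z * (r + s) ^+ 2 * (2 * q%:Z + 1) < 4 * mu * q%:Z ^+ 2.
      by apply: short_line_bound => //; lia.
    rewrite -(@ltr_pM2l _ 4) //.
    apply: (@le_lt_trans _ _ (n%:Z * (r + s) ^+ 2 * (2 * q%:Z + 1))).
      rewrite (_ : 4 * _ = n%:Z * (4 * (r * s)) * (2 * q%:Z + 1)); last by ring.
      by rewrite ler_wpM2r ?ler_wpM2l //; lia.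
    by apply: lt_le_trans bound _; rewrite -mulrA !ler_wpM2l //; lia.
  have [||||||x0 [y0 [xi yj xy x0P y0P]]] := coset_point r_gt0 s_gt0 n_gt0
    cop_rs m_mod (step_bound s s_gt0 _) (step_bound r r_gt0 _) (line_bound m _ _)
    (line_bound (r + s - m) _ _); try lia.
  apply: residue_point_mod xi yj _.
  (* A progression of [q + 1] terms suffices, since [(q + 1) ^ 2 > p]. *)
  apply: (@residue_point_near p n%:Z A _ _ x0 y0 'I_q.+1
    (fun k => s * k%:Z) (fun k => - (r * k%:Z))) x0P y0P => //.
  - by move=> k k' /(mulfI (lt0r_neq0 s_gt0)) [] /ord_inj.
  - by rewrite card_ord; lia.
  - move=> k k'; have := ltn_ord k; have := ltn_ord k'.
    rewrite -mulrBr mulrA normrM gtr0_norm ?mulr_gt0 //.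
    by rewrite ler_pM2l ?mulr_gt0 //; lia.
  - move=> k k'; have := ltn_ord k; have := ltn_ord k'.
    rewrite -opprD normrM normrN -normrM -mulrBr mulrA normrM.
    by rewrite gtr0_norm ?mulr_gt0 // ler_pM2l ?mulr_gt0 //; lia.
  - by move=> k; rewrite mulrA opprK -mulrDl dvdz_mulr.
  - exact: on_line.
have [m_lo' m_hi'] : 3 * (r + s) <= 8 * m /\ 3 * (r + s) <= 8 * (r + s - m).
  by move: m_lo m_hi N_ge4; clear; lia.
pose X := (p %/ (4 * n))%N.
have nX : 4 * (n%:Z * X%:Z) <= p%:Z.
  by have := leq_trunc_div p (4 * n); rewrite /X; lia.
have nq : 8 * (n%:Z * q%:Z) <= p%:Z.
  by apply: le_trans q2p; rewrite expr2 mulrA ler_wpM2r //; lia.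
have p_gt0 : 0 < p%:Z by lia.
have step_bound c : c <= q%:Z -> 2 * (n%:Z * X%:Z) + n%:Z * c < p%:Z.
  move=> c_le; have : n%:Z * c <= n%:Z * q%:Z by rewrite ler_wpM2l.
  by lia.
have line_bound mu : 3 * (r + s) <= 8 * mu ->
    r * (n%:Z * X%:Z) + s * (n%:Z * X%:Z) + n%:Z * r * s < mu * p%:Z.
  (* With [N = r + s], the margins cost at most [N p / 4] and the step [N p / 16], in all less than
     [3 N p / 8 <= mu p]. *)
  move=> mu_ge; rewrite -mulrDl -(@ltr_pM2l _ 16) //.
  have rsq : 2 * (r * s) <= (r + s) * q%:Z.
    have : r * s <= r * q%:Z by rewrite ler_wpM2l //; lia.
    have : r * s <= q%:Z * s by rewrite ler_wpM2r //; lia.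
    by lia.
  have rs_gt0 : 0 < r + s by rewrite addr_gt0.
  have rs_ge0 := ltW rs_gt0.
  have t1 : (r + s) * (4 * (n%:Z * X%:Z)) <= (r + s) * p%:Z.
    by rewrite ler_wpM2l.
  have t2 : n%:Z * (2 * (r * s)) <= n%:Z * ((r + s) * q%:Z).
    by rewrite ler_wpM2l.
  have t3 : (r + s) * (8 * (n%:Z * q%:Z)) <= (r + s) * p%:Z.
    by rewrite ler_wpM2l.
  have t4 : 3 * (r + s) * p%:Z <= 8 * mu * p%:Z by rewrite ler_wpM2r.
  have t5 : 0 < (r + s) * p%:Z by rewrite mulr_gt0.
  move: t1 t2 t3 t4 t5; clear; lia.
have [x0 [y0 [xi yj xy x0P y0P]]] := coset_point r_gt0 s_gt0 n_gt0 cop_rs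
  m_mod (step_bound s s_le) (step_bound r r_le) (line_bound m m_lo')
  (line_bound (r + s - m) m_hi').
apply: residue_point_mod xi yj _.
have n4_gt0 : (0 < 4 * n)%N by rewrite muln_gt0 ltnW.
have [S [S_card S_near]] := residue_cluster A (prime_gt0 p_prime) n4_gt0.
apply: (@residue_point_near p n%:Z A _ _ x0 y0 {x | x \in S}
  (fun t => (val t)%:Z) (fun t => (A * (val t)%:Z %% p%:Z)%Z)) x0P y0P => //.
- by move=> t t' [] /ord_inj /val_inj.
- rewrite card_sig (eq_card (B := S)) //.
  (* [#|S| > p / (4 n) ^ 2], and [(4 n) ^ 4 <= (70 n ^ 2) ^ 2 <= p], so [#|S| ^ 2 >= p]. *)
  apply: (leq_sqr_of_ltn_mul S_card).
  have : ((70 * n ^ 2) * (70 * n ^ 2) <= q * q)%N by rewrite leq_mul.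
  by move: q2p; clear; lia.
- move=> t t'; have := ltn_ord (val t); have := ltn_ord (val t').
  by rewrite normrM gtr0_norm // ler_pM2l // /X; lia.
- move=> t t'; rewrite normrM gtr0_norm // ler_pM2l // S_near //.
    exact: valP t.
  exact: valP t'.
- by move=> t; rewrite {1}(divz_eq (A * _) p%:Z) addrK dvdz_mull.
- exact: on_line.
Qed.

(** * Passage from the real bounds to integers, and conclusion *)

Lemma exists_floor_sqrt (m : nat) : exists q, (q ^ 2 <= m < q.+1 ^ 2)%N.
Proof.
elim: m => [|m [q qP]]; first by exists 0.
have [lt_m|le_q] := ltnP m.+1 (q.+1 ^ 2); first by exists q; lia.
by exists q.+1; nia.
Qed.

(** Apply [ln (1 + x) <= x] at [x = 1 / n - 1]. *)
Lemma ln_ge_half (R : realType) (n : nat) : (2 <= n)%N -> 1 / 2 <= ln n%:R :> R.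
Proof.
move=> n_ge2; have n_gt0 : 0 < n%:R :> R by rewrite ltr0n; lia.
have inv_n : n%:R^-1 <= 1 / 2 :> R.
  by rewrite div1r lef_pV2 ?posrE ?ler_nat // ltr0n.
have inv_gt0 : 0 < n%:R^-1 :> R by rewrite invr_gt0.
have gtN1 : -1 < n%:R^-1 - 1 :> R by lra.
by have := le_ln1Dx gtN1; rewrite addrCA subrr addr0 lnV ?posrE //; lra.
Qed.

Lemma small_quotient_dvd (p n : nat) (A r s : int) :
  coprimez r s -> 0 < s -> `|r| + s <= n%:Z -> (p%:Z %| A * s + r)%Z ->
  small_quotient p n A.
Proof.
move=> cop_rs s_gt0 le_n /dvdzP[t tE]; exists t, r, s; split=> //.
- exact/eqP.
- by lia.
- by rewrite -tE addrK intrM mulfK // intr_eq0 lt0r_neq0.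
Qed.

Lemma residue_point_fres (p n i j : nat) (A : int) :
  odd p -> residue_point p n%:Z A i%:Z j%:Z ->
  (fres p A @` Icl p n i `&` Icl p n j !=set0)%classic.
Proof.
move=> p_odd [x [y [xP yP [xi yj] Axy xres]]].
have mod_nat (z : int) (k : nat) :
    0 <= z -> (n%:Z %| z - k%:Z)%Z -> `|z|%N = k %[mod n].
  move=> z_ge0; rewrite -eqz_mod_dvd -{1}(gez0_abs z_ge0) !modz_nat.
  by move/eqP => [].
exists `|y|%N; split; last by split; [lia|apply: mod_nat => //; lia].
exists `|x|%N; first by split; [lia|apply: mod_nat => //; lia].
rewrite /fres gez0_abs; last by lia.
congr absz; rewrite -[RHS](@modz_small _ p%:Z); last by lia.
apply/eqP; rewrite eqz_mod_dvd.
(* Splitting off one factor [x] leaves the power of Euler's criterion. *)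
have -> : ((p + 1) %/ 2)%N = p.-1./2.+1 by move: p_odd; lia.
rewrite exprS (_ : _ - y = A * x * (x ^+ p.-1./2 - 1) + (A * x - y)).
  by rewrite rpredD // dvdz_mull.
by ring.
Qed.

Unset Implicit Arguments.
Local Open Scope classical_set_scope.

Theorem theorem1p6 (R : realType) (p n : nat) (A : int)
  (p_prime : prime p) (p_mod4 : p = 1 %[mod 4]) (n_ge2 : (2 <= n)%N)
  (A_small : `|A|%:~R < p%:R / 2 :> R) (A_ndvd : ~~ (p%:Z %| A)%Z)
  (p_large : p%:R > Num.max ((n%:R ^+ 3 + 1) ^+ 2)
                            (8 * 10 ^+ 4 * (n%:R * ln n%:R) ^+ 4) :> R)
  (A_nquot : ~ small_quotient p n A) :
  forall i j : nat, (i <= n - 1)%N -> (j <= n - 1)%N ->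
    (fres p A @` Icl p n i) `&` Icl p n j !=set0.
Proof.
move=> i j _ _; move: p_large; rewrite gt_max => /andP[p_cube p_log].
have {}p_cube : ((n ^ 3 + 1) ^ 2 < p)%N.
  by move: p_cube; rewrite -natrX natr1 -natrX ltr_nat addn1.
(* With [ln n >= 1 / 2] the logarithmic bound gives [p > 5000 n ^ 4], and [70 ^ 2 = 4900]. *)
have p_quart : ((70 * n ^ 2) ^ 2 < p)%N.
  rewrite -(ltr_nat R) natrX natrM natrX; apply: le_lt_trans p_log.
  have : (1 / 2) ^+ 4 <= ln n%:R ^+ 4 :> R.
    by rewrite lerXn2r ?nnegrE ?ln_ge_half // (le_trans _ (ln_ge_half R n_ge2)).
  have : 0 <= n%:R ^+ 4 :> R by rewrite exprn_ge0.
  rewrite (exprMn _ n%:R) (_ : (_ * _) ^+ 2 = 4900 * n%:R ^+ 4); last by ring.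
  set N := n%:R ^+ 4; set L := ln _ ^+ 4 => N_ge0 L_ge.
  have : N * (1 / 2) ^+ 4 <= N * L by rewrite ler_wpM2l.
  by move: (N * L) => NL; lra.
have p_odd : odd p by move: p_mod4; lia.
have [q qP] := exists_floor_sqrt p.
have q_cube : (n ^ 3 + 1 <= q)%N.
  by case/andP: qP => _ /(ltn_trans p_cube); rewrite ltn_sqr ltnS.
have q_sqr : (70 * n ^ 2 <= q)%N.
  by case/andP: qP => _ /(ltn_trans p_quart); rewrite ltn_sqr ltnS.
have q_lt : (q < p)%N by move: qP q_sqr; nia.
have [|r [s [cop_rs sP r_le Asr]]] := @thue p q A p_prime q_lt; first by lia.
have s_gt0 : 0 < s by lia.
have N_ge : n%:Z + 1 <= `|r| + s.
  rewrite leNgt; apply/negP => N_lt; apply: A_nquot.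
  by apply: small_quotient_dvd cop_rs s_gt0 _ Asr; lia.
apply: residue_point_fres => //.
have [r_gt0|r_lt0|r0] := ltrgt0P r.
- by apply: (@residue_point_pos _ _ q _ r s) => //; lia.
- apply: residue_pointN.
  apply: (@residue_point_pos _ _ q _ (- r) s) => //; try lia.
    by move: cop_rs; rewrite !coprimezE abszN.
  by rewrite mulNr -opprD rpredN.
(* If [r = 0], then [p], being prime to [A], divides [s], although [0 < s <= q < p]. *)
move: Asr; rewrite r0 addr0 Gauss_dvdzr; first by move/dvdz_lt_eq0; lia.
by rewrite coprimezE /= prime_coprime.
Qed.
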